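(* Let $P$ be a fixed finite non-empty poset and let $p$ be the number of filters of $P$. For integers $n \geq 1$ define $$M(n) = \begin{cases} \max\{kn - p^{k-1}(k(p-1) - p) \mid k \geq 1 \text{ an integer and } p^{k-1}(p-1) \leq n\} & \text{if } n \geq p-1, \\ 1 & \text{otherwise,}\end{cases}$$ $$M^{\circ}(n) = \max\{kn - p^{k-1}(k(p-1) - p) + (k-1)\delta_k - k\delta_{k-1} \mid k \geq 2 \text{ an integer and } p^{k-1}(p-1) - \delta_k + \delta_{k-1} \leq n\}$$ (with $\max\emptyset = 0$). Then, as $n \to \infty$, $$M(n) = n \log_p(n)(1 + o(1)), \qquad M^{\circ}(n) = n \log_p(n)(1 + o(1)).$$
   Context: A filter of $P$ is an up-closed subset (possibly empty). For posets $P$ and $Q$, $Q^P$ is the set of order-preserving maps from $P$ to $Q$. For $k \geq 1$, $B_k$ is the Boolean lattice of subsets of a $k$-element set, $B_k^{\circ} = B_k \setminus \{\hat{1}\}$ (all proper subsets), and $\delta_k = \left|B_k^P \setminus (B_k^{\circ})^P\right|$. *)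

(* Defs.v *)
From HB Require Import structures.
From mathcomp Require Import all_boot all_order all_algebra.
From mathcomp Require Import all_classical all_reals all_analysis.

Set Implicit Arguments.
Unset Strict Implicit.
Unset Printing Implicit Defensive.

Import Order.TTheory GRing.Theory Num.Theory.
Import numFieldNormedType.Exports.

Local Open Scope ring_scope.

Definition is_filter (d : Order.disp_t) (P : finPOrderType d) (U : {set P}) :
    bool :=
  [forall x, forall y, (x \in U) && (x <= y)%O ==> (y \in U)].

Definition num_filters (d : Order.disp_t) (P : finPOrderType d) : nat :=
  #|[set U : {set P} | is_filter U]%SET|.

(* Q^P for Q a family F of subsets of T ordered by inclusion; a map into F is
   viewed as a map into {set T} with all its values in F, so that the families
   of maps for different F can be compared. *)
Definition order_maps (d : Order.disp_t) (P : finPOrderType d) (T : finType)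
    (F : {set {set T}}) : {set {ffun P -> {set T}}} :=
  [set f : {ffun P -> {set T}} |
     [forall x, f x \in F] &&
     [forall x, forall y, (x <= y)%O ==> (f x \subset f y)]]%SET.

Definition boolean_lattice (k : nat) : {set {set 'I_k}} := [set: {set 'I_k}]%SET.

Definition proper_boolean_lattice (k : nat) : {set {set 'I_k}} :=
  (boolean_lattice k :\ [set: 'I_k])%SET.

Definition delta (d : Order.disp_t) (P : finPOrderType d) (k : nat) : nat :=
  #|(order_maps P (boolean_lattice k) :\:
     order_maps P (proper_boolean_lattice k))%SET|.

(* The greatest element of S; equal to 0 if there is none, in particular if
   S is empty. *)
Definition max_or0 (S : set int) : int := xget 0 (S `&` ubound S)%classic.

Lemma max_or0_eq (S : set int) (m : int) :
  S m -> (forall v, S v -> v <= m) -> max_or0 S = m.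
Proof.
move=> Sm mub; apply: xget_unique; first by split.
by move=> v [Sv vub]; apply/eqP; rewrite eq_le mub //= vub.
Qed.

Lemma max_or0_set0 : max_or0 set0 = 0.
Proof. by rewrite /max_or0 set0I; apply: xgetPN => v []. Qed.

Definition M (d : Order.disp_t) (P : finPOrderType d) (n : nat) : int :=
  let p := (num_filters P)%:Z in
  if p - 1 <= n%:Z then
    max_or0 [set v : int | exists k : nat,
      [/\ (1 <= k)%N,
          p ^+ k.-1 * (p - 1) <= n%:Z &
          v = k%:Z * n%:Z - p ^+ k.-1 * (k%:Z * (p - 1) - p)]]%classic
  else 1.

Definition Mcirc (d : Order.disp_t) (P : finPOrderType d) (n : nat) : int :=
  let p := (num_filters P)%:Z in
  let dl k := (delta P k)%:Z in
  max_or0 [set v : int | exists k : nat,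
    [/\ (2 <= k)%N,
        p ^+ k.-1 * (p - 1) - dl k + dl k.-1 <= n%:Z &
        v = k%:Z * n%:Z - p ^+ k.-1 * (k%:Z * (p - 1) - p)
            + (k%:Z - 1) * dl k - k%:Z * dl k.-1]]%classic.

Definition log_base (R : realType) (b x : R) : R := ln x / ln b.

(* f(n) = g(n) (1 + o(1)) as n -> oo; the equality is only required for large
   n, so that zeros of g at small n are harmless. *)
Definition eq_mul_1_plus_o1 (R : realType) (f g : nat -> R) : Prop :=
  exists e : nat -> R,
    (e @ \oo --> (0 : R))%classic /\
    (\forall n \near \oo, f n = g n * (1 + e n))%classic.

(* Main.v *)
(* Let p be the number of filters and L = log_p n. The points of P contained in
   all k filters of a tuple counted by [delta P k] form a nonempty set, and at
   most p - 1 filters contain a given point (the empty one does not), so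
   [delta P k <= #|P| * (p - 1) ^ k] and [k * delta P k = O(p ^ k)]: the
   correction terms of [Mcirc] are negligible. An admissible k has p ^ k = O(n),
   so k <= L + O(1), and the expression maximized is at most k n + O(p ^ k), hence
   at most n L + O(n). Conversely, for large n, the largest k with k p ^ k <= n is
   admissible, gives at least (k - 3) n, and satisfies
   k >= L - O(ln L) >= L - O(sqrt L). *)
Require Import Defs.
From HB Require Import structures.
From mathcomp Require Import all_boot all_order all_algebra.
From mathcomp Require Import all_classical all_reals all_analysis.
From mathcomp Require Import zify ring lra.

Set Implicit Arguments.
Unset Strict Implicit.
Unset Printing Implicit Defensive.

Import Order.TTheory GRing.Theory Num.Theory.
Import numFieldNormedType.Exports.

Local Open Scope ring_scope.

(** * Maxima of bounded sets of integers *)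

Lemma max_or0_greatest (S : set int) (m b : int) :
  S m -> (forall v, S v -> v <= b) ->
  S (max_or0 S) /\ (forall v, S v -> v <= max_or0 S).
Proof.
move=> Sm Sb.
(* Shifting by [m] turns the part of [S] from [m] upwards into a bounded nonempty set of
   naturals. *)
pose Q := fun i : nat => `[< S (m + i%:Z) >].
have exQ : exists i, Q i by exists 0%N; apply/asboolP; rewrite addr0.
have ubQ i : Q i -> (i <= absz (b - m)%R)%N.
  by move=> /asboolP /Sb; lia.
have [i /asboolP Si imax] := ex_maxnP exQ ubQ.
have Sle v : S v -> v <= m + i%:Z.
  move=> Sv; have [|mv] := leP v m; first by lia.
  have vE : v = m + (absz (v - m)%R)%:Z by lia.
  have : Q (absz (v - m)%R) by apply/asboolP; rewrite -vE.
  by move=> /imax; lia.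
by rewrite (max_or0_eq Si Sle).
Qed.

(** * Filters and the size of [delta] *)

Section OrderMaps.
Variables (d : Order.disp_t) (P : finPOrderType d).

Lemma is_filter0 : is_filter (finset.set0 : {set P}).
Proof. by apply/forallP => x; apply/forallP => y; rewrite inE. Qed.

Lemma is_filterT : is_filter [set: P].
Proof. by apply/forallP => x; apply/forallP => y; rewrite !inE implybT. Qed.

(** The empty filter and [P] itself differ because [P] is nonempty. This makes ln p positive, so
    that log_p is an increasing function. *)
Lemma num_filters_gt1 : (0 < #|P|)%N -> (1 < num_filters P)%N.
Proof.
move=> P0; have <- : #|[set finset.set0; [set: P]]%SET| = 2%N.
  rewrite cards2; case: eqP => // /(congr1 (fun A : {set P} => #|A|)).
  by rewrite cards0 cardsT => e; rewrite -e in P0.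
apply: subset_leq_card; apply/fintype.subsetP => U; rewrite !inE.
by case/orP => /eqP ->; rewrite ?is_filter0 ?is_filterT.
Qed.

Definition filters_at (x : P) : {set {set P}} :=
  [set U : {set P} | is_filter U & x \in U]%SET.

Lemma card_filters_at (x : P) : (#|filters_at x| <= (num_filters P).-1)%N.
Proof.
rewrite /num_filters (cardsD1 finset.set0) inE is_filter0 /=.
apply: subset_leq_card; apply/fintype.subsetP => U.
rewrite !inE => /andP[-> xU].
by rewrite andbT; apply: contraTneq xU => ->; rewrite inE.
Qed.

(* Currying turns a map [P -> B_k] into a [k]-tuple of filters. *)
Lemma card_order_maps_full (k : nat) (x : P) :
  (#|[set f in order_maps P (boolean_lattice k) | f x == [set: 'I_k]]%SET|
     <= (num_filters P).-1 ^ k)%N.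
Proof.
pose curry (f : {ffun P -> {set 'I_k}}) : {ffun 'I_k -> {set P}} :=
  [ffun i => [set y | i \in f y]%SET].
have curry_inj : injective curry.
  move=> f g /ffunP fg; apply/ffunP => y; apply/setP => i.
  by have /setP/(_ y) := fg i; rewrite !ffunE !inE.
rewrite -(card_imset _ curry_inj).
(* Since [f x] is the full set, every filter of the tuple contains [x]. *)
apply: (@leq_trans #|(@ffun_on_mem 'I_k _ (mem (filters_at x)))|); last first.
  by rewrite card_ffun_on card_ord; case: k {curry curry_inj} => // k;
    rewrite leq_exp2r //; exact: card_filters_at.
apply: subset_leq_card; apply/fintype.subsetP => _ /imsetP[f + ->].
rewrite !inE => /andP[/andP[_ /forallP fmono] /eqP fx].
apply/ffun_onP => i; rewrite ffunE !inE fx inE andbT.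
apply/forallP => y; apply/forallP => z; rewrite !inE.
apply/implyP => /andP[iy yz].
by have /forallP/(_ z)/implyP/(_ yz)/fintype.subsetP := fmono y; exact.
Qed.

(** A map that leaves the proper subsets is full at some point; sum over that point. *)
Lemma delta_le (k : nat) : (delta P k <= #|P| * (num_filters P).-1 ^ k)%N.
Proof.
pose full x :=
  [set f in order_maps P (boolean_lattice k) | f x == [set: 'I_k]]%SET.
apply: (@leq_trans #|(\bigcup_x full x)%SET|).
  apply: subset_leq_card; apply/fintype.subsetP => f.
  rewrite inE => /andP[fN fM].
  have [x fx] : exists x, f x == [set: 'I_k].
    apply/existsP; apply: contraNT fN; rewrite negb_exists => /forallP fN.
    move: fM; rewrite !inE => /andP[_ ->]; rewrite andbT.
    by apply/forallP => x; rewrite !inE fN.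
  by apply/bigcupP; exists x => //; rewrite inE fM.
apply: (@leq_trans (\sum_(x : P) #|full x|)%N).
  elim/big_rec2: _ => [|x m A _ Am]; first by rewrite cards0.
  by apply: leq_trans (leq_card_setU _ _) _; rewrite leq_add2l.
by rewrite -sum_nat_const; apply: leq_sum => x _; exact: card_order_maps_full.
Qed.
End OrderMaps.

(** * Integer estimates for the thresholds and the maximized values *)

Lemma muln_expn_le (q k : nat) : (k * q ^ k <= q * q.+1 ^ k)%N.
Proof.
(* Bernoulli's inequality (1 + 1/q)^k >= 1 + k/q, cleared of denominators; this stronger form passes
   through the induction. *)
suff h : ((q + k) * q ^ k <= q * q.+1 ^ k)%N.
  by apply: leq_trans h; rewrite leq_mul2r leq_addl orbT.
elim: k => [|k IH]; first by rewrite !expn0; lia.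
rewrite !expnS.
have : ((q + k) * q ^ k * q.+1 <= q * q.+1 ^ k * q.+1)%N.
  by rewrite leq_mul2r IH orbT.
by nia.
Qed.

Lemma Posz_exp (m k : nat) : m%:Z ^+ k = (m ^ k)%N%:Z.
Proof. by elim: k => // k IH; rewrite exprS IH expnS PoszM. Qed.

(* [threshold] and [value] are the bound and the maximized expression in [Mcirc]
   with [dl] for [delta P]; those in [M] are the case where [dl] vanishes. *)
Definition threshold (p : nat) (dl : nat -> nat) (k : nat) : int :=
  p%:Z ^+ k.-1 * (p%:Z - 1) - (dl k)%:Z + (dl k.-1)%:Z.

Definition value (p : nat) (dl : nat -> nat) (n k : nat) : int :=
  k%:Z * n%:Z - p%:Z ^+ k.-1 * (k%:Z * (p%:Z - 1) - p%:Z)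
  + (k%:Z - 1) * (dl k)%:Z - k%:Z * (dl k.-1)%:Z.

Section Bounds.
Variables (p C : nat) (dl : nat -> nat).
Hypothesis p_gt1 : (1 < p)%N.
Hypothesis dl_le : forall k, (k * dl k <= C * p ^ k)%N.

(** For k <= 2Cp, p^k is bounded by a constant. For larger k, [dl k] is at most half of p^(k-1), so
    the threshold is at least p^(k-1)/2. *)
Lemma threshold_expn_le (n k : nat) : (0 < n)%N -> (0 < k)%N ->
  threshold p dl k <= n%:Z -> (p ^ k <= (2 * p + p ^ (2 * C * p)) * n)%N.
Proof.
move=> n0 k0; have [kC _|Ck] := leqP k (2 * C * p).
  have : (p ^ k <= p ^ (2 * C * p))%N by rewrite leq_exp2l.
  by nia.
case: k k0 Ck => // k _ Ck; rewrite /threshold /= Posz_exp => thr.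
have := dl_le k.+1; rewrite expnS; set q := (p ^ k)%N in thr *.
(* Compare 2Cp [dl k.+1] <= (k+1) [dl k.+1] <= Cpq and cancel Cp; if C = 0, then [dl k.+1] is 0. *)
move=> dlk; have dlq : (2 * dl k.+1 <= q)%N.
  case: (posnP C) dlk Ck => [-> |C0] dlk Ck; first by nia.
  rewrite -(@leq_pmul2l (C * p)); last by nia.
  have h : (2 * C * p * dl k.+1 <= k.+1 * dl k.+1)%N.
    by rewrite leq_mul2r ltnW ?orbT.
  by nia.
have : (q <= 2 * n)%N by nia.
by nia.
Qed.

(** Once the negative terms are dropped, p^(k-1) p and (k-1) [dl k] remain; they give the 1 and the
    C. *)
Lemma value_le (n k : nat) : (0 < k)%N ->
  value p dl n k <= (k * n + (1 + C) * p ^ k)%N%:Z.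
Proof.
case: k => // k _; rewrite /value /= Posz_exp.
have := dl_le k.+1; rewrite expnS; set q := (p ^ k)%N => dlk.
have e : ((k.+1%:Z - 1) * (dl k.+1)%:Z <= (C * (p * q))%N%:Z) by nia.
have : 0 <= q%:Z * (k.+1%:Z * (p%:Z - 1)) by nia.
nia.
Qed.

Lemma threshold_le (n k : nat) : (1 < k)%N -> (C <= k)%N ->
  (k * p ^ k <= n)%N -> threshold p dl k <= n%:Z.
Proof.
case: k => [//|[//|k]] _ Ck; rewrite /threshold /= Posz_exp.
have := dl_le k.+1; rewrite [(p ^ k.+2)%N]expnS.
set q := (p ^ k.+1)%N => dlk kn.
have e : (dl k.+1 <= C * q)%N by nia.
have e2 : (dl k.+1 <= k.+2 * q)%N by nia.
have e3 : (k.+2 * (p * q) >= k.+2 * q + (p - 1) * q)%N.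
  by nia.
nia.
Qed.

(** Of the 3n lost, one n pays for p^(k-1) (k(p-1) - p) <= k p^k, and two pay for k [dl k.-1], using
    k <= 2(k-1). *)
Lemma value_ge (n k : nat) : (1 < k)%N -> (C <= k)%N ->
  (k * p ^ k <= n)%N -> (k%:Z - 3) * n%:Z <= value p dl n k.
Proof.
case: k => [//|[//|k]] _ Ck; rewrite /value /= Posz_exp.
have := dl_le k.+1; rewrite [(p ^ k.+2)%N]expnS.
set q := (p ^ k.+1)%N => dlk kn.
have e : (k.+2 * dl k.+1 <= 2 * n)%N.
  have : (k.+2 * dl k.+1 <= 2 * (C * q))%N by nia.
  have : (C * q <= k.+2 * q)%N by nia.
  have : (k.+2 * q <= k.+2 * (p * q))%N by nia.
  lia.
have e2 : q%:Z * (k.+2%:Z * (p%:Z - 1) - p%:Z) <= (k.+2 * (p * q))%N%:Z by nia.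
have e3 : 0 <= (k.+2%:Z - 1) * (dl k.+1)%:Z by nia.
nia.
Qed.

Lemma ex_index (n m : nat) : (m * p ^ m <= n)%N ->
  exists k, [/\ (m <= k)%N, (k * p ^ k <= n)%N & (n < k.+1 * p ^ k.+1)%N].
Proof.
move=> mn; pose Q := fun k => (k * p ^ k <= n)%N.
have ubQ k : Q k -> (k <= n)%N.
  by apply: leq_trans; rewrite leq_pmulr // expn_gt0; lia.
have [k Qk kmax] := ex_maxnP (ex_intro Q m mn) ubQ.
exists k; split => //; first exact: kmax.
by rewrite ltnNge; apply/negP => /kmax; rewrite ltnn.
Qed.

End Bounds.

(** * Real asymptotics, with L = log_p n *)

Section Asymptotics.
Variable R : realType.

Lemma log_base_near_ge (b r : R) : 1 < b ->
  (\forall n \near \oo, r <= log_base b n%:R)%classic.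
Proof.
move=> b1; have lb : 0 < ln b by rewrite ln_gt0.
near=> n.
have rn : expR (r * ln b) <= n%:R by near: n; exact: nbhs_infty_ger.
have n0 : 0 < n%:R :> R by apply: lt_le_trans rn; exact: expR_gt0.
by rewrite /log_base ler_pdivlMr // -[leLHS]expRK ler_ln ?posrE ?expR_gt0.
Unshelve. all: by end_near.
Qed.

Lemma eq_mul_1_plus_o1_sqrt (b K : R) (F : nat -> R) : 1 < b ->
  (\forall n \near \oo, `|F n - n%:R * log_base b n%:R|
      <= K * (n%:R * Num.sqrt (log_base b n%:R)))%classic ->
  eq_mul_1_plus_o1 F (fun n => n%:R * log_base b n%:R).
Proof.
move=> b1 FK; exists (fun n => F n / (n%:R * log_base b n%:R) - 1); split.
  apply/cvgr0Pnorm_le => eps eps0; near=> n.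
  have L1 : 1 <= log_base b n%:R by near: n; exact: log_base_near_ge.
  (* The relative error is at most K / sqrt L, hence at most eps from here on. *)
  have Le : (K / eps) ^+ 2 <= log_base b n%:R
    by near: n; exact: log_base_near_ge.
  have n0 : 0 < n%:R :> R by rewrite ltr0n; near: n; exact: nbhs_infty_gt.
  have Fn : `|F n - n%:R * log_base b n%:R|
      <= K * (n%:R * Num.sqrt (log_base b n%:R)) by near: n.
  set L := log_base b n%:R in L1 Le Fn *.
  have L0 : 0 < L by lra.
  have sL : 0 < Num.sqrt L by rewrite sqrtr_gt0.
  have -> : F n / (n%:R * L) - 1 = (F n - n%:R * L) / (n%:R * L).
    by rewrite mulrBl divff // mulf_neq0 // gt_eqF.
  rewrite normrM normfV (gtr0_norm (mulr_gt0 n0 L0)).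
  rewrite ler_pdivrMr ?(mulr_gt0 n0 L0) //.
  apply: le_trans Fn _.
  have KsL : K <= eps * Num.sqrt L.
    rewrite -ler_pdivrMl // mulrC.
    apply: le_trans (ler_norm _) _.
    by rewrite -sqrtr_sqr ler_sqrt // ltW.
  have -> : eps * (n%:R * L) = eps * Num.sqrt L * (n%:R * Num.sqrt L).
    by rewrite -{1}(sqr_sqrtr (ltW L0)); ring.
  by rewrite ler_wpM2r // mulr_ge0 ?ltW.
near=> n.
have L1 : 1 <= log_base b n%:R by near: n; exact: log_base_near_ge.
have n0 : 0 < n%:R :> R by rewrite ltr0n; near: n; exact: nbhs_infty_gt.
by rewrite addrC subrK mulrC divfK // mulf_neq0 // gt_eqF //; lra.
Unshelve. all: by end_near.
Qed.

(** Apply ln y < y to y = sqrt(1 + x), and use 1 + x <= 4x. *)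
Lemma ln_le_sqrt (x : R) : 1 <= x -> ln (1 + x) <= 4 * Num.sqrt x.
Proof.
move=> x1; have x0 : 0 < 1 + x by lra.
have s0 : 0 < Num.sqrt (1 + x) by rewrite sqrtr_gt0.
have -> : ln (1 + x) = 2 * ln (Num.sqrt (1 + x)).
  by rewrite -{1}(sqr_sqrtr (ltW x0)) lnXn // mulr_natl.
have : Num.sqrt (1 + x) <= 2 * Num.sqrt x.
  rewrite -[2]ger0_norm // -sqrtr_sqr -sqrtrM ?sqr_ge0 //.
  rewrite ler_sqrt; first by lra.
  by apply: mulr_ge0; lra.
have := ln_sublinear s0; lra.
Qed.

Lemma ln_expn (b k : nat) : (0 < b)%N -> ln ((b ^ k)%N%:R : R) = k%:R * ln b%:R.
Proof. by move=> b0; rewrite natrX lnXn ?ltr0n // mulr_natl. Qed.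

(** The least index [k0] is 1 for [M] and 2 for [Mcirc]. *)
Definition values (p : nat) (dl : nat -> nat) (k0 n : nat) : set int :=
  [set v : int | exists k : nat,
     [/\ (k0 <= k)%N, threshold p dl k <= n%:Z & v = value p dl n k]]%classic.

Lemma values_le (p C : nat) (dl : nat -> nat) : (1 < p)%N ->
  (forall k, k * dl k <= C * p ^ k)%N ->
  exists2 A : R, 0 <= A & forall (k0 n : nat) (v : int),
    (0 < k0)%N -> (0 < n)%N -> values p dl k0 n v ->
    v%:~R <= n%:R * (log_base p%:R n%:R + A).
Proof.
move=> p_gt1 dl_le; pose D := (2 * p + p ^ (2 * C * p))%N.
have D0 : (0 < D)%N by rewrite /D; lia.
have lnp_gt0 : 0 < ln (p%:R : R) by rewrite ln_gt0 // ltr1n.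
(* From p^k <= D n: the first summand bounds k - L, the second bounds (1 + C) p^k / n. *)
exists (ln D%:R / ln p%:R + ((1 + C) * D)%N%:R) => [|k0 n v k00 n0].
  by rewrite addr_ge0 // divr_ge0 ?(ltW lnp_gt0) // ln_ge0 // ler1n.
move=> [k [k0k /(threshold_expn_le p_gt1 dl_le n0 (leq_trans k00 k0k)) pk ->]].
have vle := value_le p_gt1 dl_le n (leq_trans k00 k0k).
have kL : k%:R <= log_base p%:R n%:R + ln D%:R / ln p%:R :> R.
  rewrite /log_base -mulrDl ler_pdivlMr // -ln_expn 1?ltnW // addrC.
  rewrite -lnM ?posrE ?ltr0n // -natrM ler_ln ?posrE ?ltr0n ?ler_nat //.
    by rewrite expn_gt0 ltnW.
  by rewrite muln_gt0 D0.
have vD : value p dl n k <= (n * (k + (1 + C) * D))%N%:Z.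
  apply: le_trans vle _; rewrite lez_nat mulnDr mulnC leq_add2l.
  by rewrite mulnCA leq_mul2l /= mulnC.
have vDR : (value p dl n k)%:~R <= (n * (k + (1 + C) * D))%N%:R :> R.
  by rewrite -[leRHS]/((_%:Z)%:~R) ler_int.
by apply: le_trans vDR _; rewrite natrM ler_wpM2l // natrD addrA lerD2r.
Qed.

Lemma values_ge (p C : nat) (dl : nat -> nat) (k0 : nat) : (1 < p)%N ->
  (forall k, k * dl k <= C * p ^ k)%N -> (k0 <= 2)%N ->
  exists2 B : R, 0 <= B & (\forall n \near \oo,
    exists2 v, values p dl k0 n v &
    n%:R * (log_base p%:R n%:R - B * Num.sqrt (log_base p%:R n%:R))
      <= v%:~R)%classic.
Proof.
move=> p_gt1 dl_le k02.
have p_gt1R : 1 < p%:R :> R by rewrite ltr1n.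
have lnp_gt0 : 0 < ln (p%:R : R) by rewrite ln_gt0.
(* As L <= k + 1 + ln(k+1) / ln p, the factor k - 3 is at least L - 4 - ln(k+1) / ln p, where
   ln(k+1) <= 4 sqrt L and 4 <= 4 sqrt L. *)
exists (4 + 4 / ln p%:R); first by rewrite addr_ge0 // divr_ge0 // ltW.
near=> n; set L := log_base p%:R n%:R.
have L1 : 1 <= L by rewrite /L; near: n; exact: log_base_near_ge.
(* Starting the search at C + 2 ensures both k >= 2 and k >= C. *)
have : ((C + 2) * p ^ (C + 2) <= n)%N by near: n; exact: nbhs_infty_ge.
move=> /(ex_index p_gt1)[k [Ck kn nk]].
have [k2 Ck'] : (1 < k)%N /\ (C <= k)%N by split; lia.
exists (value p dl n k).
  exists k; split => //; first by lia.
  exact: (threshold_le p_gt1 dl_le).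
have := value_ge p_gt1 dl_le k2 Ck' kn; rewrite -(ler_int R); apply: le_trans.
rewrite intrM mulrC ler_wpM2r // intrB.
have n0 : (0 < n)%N.
  by apply: leq_trans kn; rewrite muln_gt0 expn_gt0 (ltnW p_gt1) ltnW.
have pk0 : (0 < p ^ k)%N by rewrite expn_gt0 ltnW.
have kL : k%:R <= L.
  rewrite /log_base ler_pdivlMr // -ln_expn 1?ltnW //.
  rewrite ler_ln ?posrE ?ltr0n ?ler_nat //.
  by apply: leq_trans kn; rewrite leq_pmull // ltnW.
have Lk : L <= k.+1%:R + ln k.+1%:R / ln p%:R.
  rewrite -[X in X + _](mulfK (lt0r_neq0 lnp_gt0)) -mulrDl.
  rewrite /log_base ler_pM2r ?invr_gt0 // -ln_expn 1?ltnW //.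
  rewrite addrC -lnM ?posrE ?ltr0n ?expn_gt0 ?(ltnW p_gt1) // -natrM.
  by rewrite ler_ln ?posrE ?ltr0n ?ler_nat
    ?muln_gt0 ?expn_gt0 ?(ltnW p_gt1) // ltnW.
have lk : ln k.+1%:R <= 4 * Num.sqrt L.
  apply: le_trans (ln_le_sqrt L1).
  by rewrite -natr1 addrC ler_ln ?posrE ?lerD2l //; lra.
have lk' : ln k.+1%:R / ln p%:R <= 4 / ln p%:R * Num.sqrt L.
  by rewrite mulrAC ler_pM2r // invr_gt0.
have s1 : 1 <= Num.sqrt L by rewrite -[leLHS]sqrtr1 ler_sqrt //; lra.
have := le_trans Lk (lerD (lexx _) lk'); rewrite -natr1; lra.
Unshelve. all: by end_near.
Qed.

Lemma max_values_asymptotic (p C : nat) (dl : nat -> nat) (k0 : nat) :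
  (1 < p)%N -> (forall k, k * dl k <= C * p ^ k)%N -> (0 < k0 <= 2)%N ->
  eq_mul_1_plus_o1 (fun n => (max_or0 (values p dl k0 n))%:~R)
                   (fun n => n%:R * log_base (p%:R : R) n%:R).
Proof.
move=> p_gt1 dl_le /andP[k00 k02].
have p_gt1R : 1 < p%:R :> R by rewrite ltr1n.
have [A A0 leA] := values_le p_gt1 dl_le.
have [B B0 geB] := values_ge p_gt1 dl_le k02.
(* The upper error A n is absorbed into A n sqrt L, as L >= 1. *)
apply: (@eq_mul_1_plus_o1_sqrt p%:R (A + B)) => //.
near=> n.
have n0 : (0 < n)%N by near: n; exact: nbhs_infty_gt.
have := near geB n; move=> /(_ _)[//|v vS].
set L := log_base p%:R n%:R => vge.
have L1 : 1 <= L by rewrite /L; near: n; exact: log_base_near_ge.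
(* The ceiling provides an integer bound, so the maximum is attained and is not the default 0. *)
have ub w : values p dl k0 n w -> w <= Num.ceil (n%:R * (L + A)).
  move=> /(leA _ _ _ k00 n0) wle; rewrite -(ler_int R).
  by apply: le_trans wle _; exact: ceil_ge.
have [/(leA _ _ _ k00 n0) mle /(_ _ vS)] := max_or0_greatest vS ub.
rewrite -(ler_int R) => vm.
have s1 : 1 <= Num.sqrt L by rewrite -[leLHS]sqrtr1 ler_sqrt //; lra.
have nR : 0 <= n%:R :> R by [].
have : 0 <= n%:R * (A * (Num.sqrt L - 1)).
  by rewrite !mulr_ge0 // subr_ge0.
have : 0 <= n%:R * (B * Num.sqrt L) by rewrite !mulr_ge0 // (le_trans _ s1).
have : 0 <= n%:R * (A * Num.sqrt L) by rewrite !mulr_ge0 // (le_trans _ s1).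
rewrite ler_norml; move: mle; rewrite -/L.
by move=> mle h1 h2 h3; apply/andP; split; lra.
Unshelve. all: by end_near.
Qed.

End Asymptotics.

(** * Specialization to [M] and [Mcirc] *)

Lemma M_eq (d : Order.disp_t) (P : finPOrderType d) (n : nat) :
  (num_filters P <= n.+1)%N ->
  M P n = max_or0 (values (num_filters P) (fun=> 0%N) 1 n).
Proof.
move=> pn; rewrite /M ifT; last by lia.
congr max_or0; apply/seteqP; split => v /= [k [k1 thr ->]]; exists k;
  rewrite /threshold /value ?mulr0 ?subr0 ?addr0 in thr *; by split.
Qed.

Lemma eq_mul_1_plus_o1_near (R : realType) (f f' g : nat -> R) :
  (\forall n \near \oo, f n = f' n)%classic ->
  eq_mul_1_plus_o1 f g -> eq_mul_1_plus_o1 f' g.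
Proof.
move=> ff' [e [e0 fe]]; exists e; split => //.
by near=> n; rewrite -(near ff' n) // (near fe n).
Unshelve. all: by end_near.
Qed.

Theorem theorem4p10p5 (R : realType) (d : Order.disp_t) (P : finPOrderType d)
    (P_nonempty : (0 < #|P|)%N) :
  let p : R := (num_filters P)%:R in
  eq_mul_1_plus_o1 (fun n : nat => (M P n)%:~R)
                   (fun n : nat => n%:R * log_base p n%:R) /\
  eq_mul_1_plus_o1 (fun n : nat => (Mcirc P n)%:~R)
                   (fun n : nat => n%:R * log_base p n%:R).
Proof.
have p1 := num_filters_gt1 P_nonempty; split.
  apply: (@eq_mul_1_plus_o1_near _
    (fun n => (max_or0 (values (num_filters P) (fun=> 0%N) 1 n))%:~R)).
    by near=> n; rewrite M_eq // leqW //; near: n; exact: nbhs_infty_ge.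
  by apply: (@max_values_asymptotic _ _ 0) => // k; rewrite muln0.
(* With q = p - 1: k [delta P k] <= |P| k q^k <= |P| q p^k, so C = |P| q. *)
apply: (@max_values_asymptotic R _ (#|P| * (num_filters P).-1) (delta P)) =>
  // k.
have := muln_expn_le (num_filters P).-1 k; rewrite prednK ?(ltnW p1) // => kq.
apply: (@leq_trans (#|P| * (k * (num_filters P).-1 ^ k))%N).
  by rewrite mulnCA leq_mul2l delta_le orbT.
by rewrite -mulnA leq_mul2l kq orbT.
Unshelve. all: by end_near.
Qed.
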